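(* There is a minimal subset of $\mathbb{R}$ that is reducible to $\mathbb{Q}$.
   Context: For subsets $A,B$ of $\mathbb{R}$, $A\leq B$ ($A$ is reducible to $B$) means that there is a continuous function $f\colon\mathbb{R}\to\mathbb{R}$ with $A=f^{-1}(B)$. A subset of $\mathbb{R}$ is non-trivial if both it and its complement are nonempty. A non-trivial set $A\subseteq\mathbb{R}$ is called minimal if it is minimal with respect to the quasi-order $\leq$ among all non-trivial subsets of $\mathbb{R}$, i.e. for every non-trivial $B\subseteq\mathbb{R}$ with $B\leq A$ we have $A\leq B$. *)

(* Defs.v *)
From mathcomp Require Import all_boot all_order all_algebra.
From mathcomp Require Import all_classical all_reals all_analysis.

Set Implicit Arguments.
Unset Strict Implicit.
Unset Printing Implicit Defensive.

Import Order.TTheory GRing.Theory Num.Theory.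
Import numFieldNormedType.Exports.

Local Open Scope classical_set_scope.
Local Open Scope ring_scope.

Definition reducible (R : realType) (A B : set R) : Prop :=
  exists2 f : R -> R, continuous f & A = f @^-1` B.

Definition nontrivial (R : realType) (A : set R) : Prop :=
  A !=set0 /\ ~` A !=set0.

Definition minimal (R : realType) (A : set R) : Prop :=
  nontrivial A /\
  forall B : set R, nontrivial B -> reducible B A -> reducible A B.

(* Main.v *)
(* There is a set [fractal] which reduces to [f^-1(Q)] for every nonconstant
   continuous [f]; the case [f = id] and the fact that every set reducible to
   [fractal] has the form [f^-1(Q)] give the theorem.

   The line is cut into 5-adic cells, and an automaton assigns a kind to each
   cell.  A gap contains a Cantor-like portion of a new level, red (in [Q]) or
   blue (irrational); a portion consists of smaller portions, of gaps and of
   plateaus of its level.  A point is red iff it gets trapped in a red level.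
   Given [f], a path [h] is built along this subdivision, mapping portions to
   pieces of level sets of [f] and gaps to intervals between them.  Superfluous
   gaps of [fractal] become small loops; plateaus of [fractal] allow [h] to cross
   the plateaus of [f].  The levels are chosen from an enumeration of [Q] and
   from one of a dense set of irrationals that contains the irrational values of
   [f] on [Q], hence those of all plateaus of [f].  Since every enumerated level
   is used up, the images of the cells shrink to points, and a point that is
   never trapped in a level has an irrational value. *)
Require Import Defs.
From mathcomp Require Import all_boot all_order all_algebra.
From mathcomp Require Import all_classical all_reals all_analysis.
From mathcomp Require Import ring lra zify.

Set Implicit Arguments.
Unset Strict Implicit.
Unset Printing Implicit Defensive.

Import Order.TTheory GRing.Theory Num.Theory.
Import numFieldNormedType.Exports.

Local Open Scope classical_set_scope.
Local Open Scope ring_scope.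

(** * Hits and plateaus of a level of a continuous function *)

Lemma continuous_dist (R : realType) (f : R -> R) (x e : R) :
  continuous f -> 0 < e ->
  exists2 d, 0 < d & forall y, `|y - x| < d -> `|f y - f x| < e.
Proof.
move=> cf e0; have /cvgrPdist_lt/(_ e e0)/nbhs_ballP[d /= d0 H] := cf x.
exists d => // y yx; rewrite distrC; apply: H.
by rewrite /ball /= distrC.
Qed.

Lemma continuous_neq (R : realType) (f : R -> R) (x g : R) :
  continuous f -> f x <> g ->
  exists2 d, 0 < d & forall y, `|y - x| < d -> f y <> g.
Proof.
move=> cf /eqP fx; have [|d d0 H] := @continuous_dist R f x `|f x - g| cf.
  by rewrite normr_gt0 subr_eq0.
by exists d => // y /H + fy; rewrite fy distrC ltxx.
Qed.

(** Reflection turns last hits and left sides into first hits and right sides, so that only one of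
    each is treated directly. *)
Lemma continuous_flip (R : realType) (f : R -> R) :
  continuous f -> continuous (fun x => f (- x)).
Proof.
move=> cf x; apply: (@continuous_comp _ _ _ (fun x => - x) f).
  exact: opp_continuous.
exact: cf.
Qed.

Lemma last_hit (R : realType) (f : R -> R) (a m g : R) :
  continuous f -> a <= m -> f a = g -> f m <> g ->
  exists u, [/\ a <= u, u < m, f u = g &
    forall x, u < x -> x <= m -> f x <> g].
Proof.
move=> cf am fa fm.
pose E := [set x | [/\ a <= x, x <= m & f x = g]].
have Ea : E a by [].
have hE : has_sup E by split; [exists a | exists m => x []].
have su := sup_upper_bound hE.
have sm : sup E <= m by apply: ge_sup; [exists a | move=> x []].
have fs : f (sup E) = g.
  apply: contrapT => /(continuous_neq cf)[d d0 H].
  have [x Ex sx] := sup_adherent d0 hE.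
  have xs := su _ Ex; have [_ _ fx] := Ex.
  by apply: (H x) => //; rewrite ltr_norml; apply/andP; split; lra.
exists (sup E); split => //; first exact: su.
  rewrite lt_neqAle sm andbT; apply/eqP => sE; apply: fm; by rewrite -sE.
move=> x sx xm fx; have : E x.
  by split => //; apply: le_trans (su _ Ea) (ltW sx).
by move=> /su; rewrite leNgt sx.
Qed.

Lemma first_hit (R : realType) (f : R -> R) (m b g : R) :
  continuous f -> m <= b -> f b = g -> f m <> g ->
  exists v, [/\ m < v, v <= b, f v = g &
    forall x, m <= x -> x < v -> f x <> g].
Proof.
move=> cf mb fb fm.
have [|||u [bu um fu H]] := @last_hit R _ (- b) (- m) g (continuous_flip cf).
- by rewrite lerN2.
- by rewrite opprK.
- by rewrite opprK.
exists (- u); split => //; [lra|lra|].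
by move=> x mx xu; rewrite -[x]opprK; apply: H; lra.
Qed.

(** [p] is the supremum of the points of [[a, m]] off the level, or [a] if there are none. The last
    clause expresses maximality: unless [p = a], such points accumulate at [p] from the left. *)
Lemma plateau_left (R : realType) (f : R -> R) (a m g : R) :
  continuous f -> a <= m -> f a = g -> f m = g ->
  exists p, [/\ a <= p, p <= m, forall x, p <= x -> x <= m -> f x = g &
    a < p -> forall y, y < p -> exists x, [/\ y < x, x < p & f x <> g]].
Proof.
move=> cf am fa fm.
pose E := [set x | [/\ a <= x, x <= m & f x <> g]].
have [E0|E0] := pselect (E !=set0); last first.
  exists a; split => //; last by rewrite ltxx.
  by move=> x ax xm; apply: contrapT => fx; apply: E0; exists x.
have hE : has_sup E by split => //; exists m => x [].
have su := sup_upper_bound hE.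
have sm : sup E <= m by apply: ge_sup => // x [].
have sa : a <= sup E by have [x Ex] := E0; apply: le_trans (su _ Ex); case: Ex.
have above x : sup E < x -> x <= m -> f x = g.
  move=> sx xm; apply: contrapT => fx.
  have : E x by split => //; apply: le_trans sa (ltW sx).
  by move=> /su; rewrite leNgt sx.
have fs : f (sup E) = g.
  move: sm; rewrite le_eqVlt => /predU1P[->//|sm].
  apply: contrapT => /(continuous_neq cf)[d d0 H].
  pose y := Num.min m (sup E + d / 2).
  have ym : y <= m by rewrite ge_min lexx.
  have yd : y <= sup E + d / 2 by rewrite ge_min lexx orbT.
  have ys : sup E < y by rewrite lt_min sm; lra.
  by apply: (H y) (above _ ys ym); rewrite ltr_norml; apply/andP; split; lra.
exists (sup E); split => // [x|ap y yp].
  by rewrite le_eqVlt => /predU1P[<-//|]; exact: above.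
have [|x Ex yx] := @sup_adherent R E (sup E - y) _ hE; first by rewrite subr_gt0.
exists x; split; [lra| |by case: Ex].
rewrite lt_neqAle su // andbT; apply/eqP => xs.
by case: Ex => _ _; rewrite xs.
Qed.

Lemma plateau_right (R : realType) (f : R -> R) (m b g : R) :
  continuous f -> m <= b -> f b = g -> f m = g ->
  exists q, [/\ m <= q, q <= b, forall x, m <= x -> x <= q -> f x = g &
    q < b -> forall y, q < y -> exists x, [/\ q < x, x < y & f x <> g]].
Proof.
move=> cf mb fb fm.
have [|||p [bp pm H1 H2]] :=
  @plateau_left R _ (- b) (- m) g (continuous_flip cf).
- by rewrite lerN2.
- by rewrite opprK.
- by rewrite opprK.
exists (- p); split => //; [lra|lra| |].
  by move=> x mx xu; rewrite -[x]opprK; apply: H1; lra.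
move=> pb y py; have [||x [yx xp fx]] := H2 _ (- y); [lra|lra|].
by exists (- x); split => //; lra.
Qed.

(** * Escapable points and the splitting of portions *)

Definition avoids_left {R : realType} (f : R -> R) (u : R) :=
  exists2 d, 0 < d & forall x, u - d < x -> x < u -> f x <> f u.

Definition avoids_right {R : realType} (f : R -> R) (u : R) :=
  exists2 d, 0 < d & forall x, u < x -> x < u + d -> f x <> f u.

(* A portion of a level set starting at [u] towards [v] contains gaps.  They can
   be realized near [u]: either by loops on a side where [f] avoids [f u], or,
   when [u <> v], because [u] is not the start of a plateau. *)
Definition escapable {R : realType} (f : R -> R) (u v : R) :=
  [\/ avoids_left f u, avoids_right f u,
    u < v /\ (forall y, u < y -> exists x, [/\ u < x, x < y & f x <> f u]) |
    v < u /\ (forall y, y < u -> exists x, [/\ y < x, x < u & f x <> f u])].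

Lemma avoids_left_flip (R : realType) (f : R -> R) (u : R) :
  avoids_left (fun x => f (- x)) u -> avoids_right f (- u).
Proof.
move=> [d d0 H]; exists d => // x ux xd.
by rewrite -[x]opprK; apply: H; lra.
Qed.

Lemma avoids_right_flip (R : realType) (f : R -> R) (u : R) :
  avoids_right (fun x => f (- x)) u -> avoids_left f (- u).
Proof.
move=> [d d0 H]; exists d => // x ux xd.
by rewrite -[x]opprK; apply: H; lra.
Qed.

Lemma escapable_flip (R : realType) (f : R -> R) (u v : R) :
  escapable (fun x => f (- x)) u v -> escapable f (- u) (- v).
Proof.
case=> [/avoids_left_flip|/avoids_right_flip|[uv H]|[uv H]].
- exact: Or42.
- exact: Or41.
- apply: Or44; split; first lra.
  move=> y yu; have [|x [ux xy fx]] := H (- y); first lra.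
  by exists (- x); split => //; lra.
- apply: Or43; split; first lra.
  move=> y yu; have [|x [ux xy fx]] := H (- y); first lra.
  by exists (- x); split => //; lra.
Qed.

Lemma escapable_self (R : realType) (f : R -> R) (u : R) :
  escapable f u u -> avoids_left f u \/ avoids_right f u.
Proof. by case; [left|right|rewrite ltxx => -[]|rewrite ltxx => -[]]. Qed.

(** Provides the gaps of [fractal] that have no counterpart in the level set: the path leaves [u]
    into a one-sided interval and comes back. *)
Lemma small_loop (R : realType) (f : R -> R) (u lo hi : R) :
  avoids_left f u \/ avoids_right f u -> lo < u -> u < hi ->
  exists glo ghi, [/\ lo <= glo, ghi <= hi, glo < ghi, u = glo \/ u = ghi &
    forall x, glo < x -> x < ghi -> f x <> f u].
Proof.
case=> -[d d0 H] lou uhi.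
  exists (Num.max lo (u - d)), u; split; [|by apply: ltW| | by right|].
  - by rewrite le_max lexx.
  - by rewrite gt_max lou; lra.
  - by move=> x; rewrite gt_max => /andP[_ ?] ?; apply: H.
exists u, (Num.min hi (u + d)); split; [by apply: ltW| | | by left|].
- by rewrite ge_min lexx.
- by rewrite lt_min uhi; lra.
- by move=> x ux; rewrite lt_min => /andP[_ ?]; apply: H.
Qed.

(** The five stretches of a path from [a] to [b], in the order of [child (Portion c)]: portion from
    [a] to [u], gap from [u] to [v], portion from [v] to [p], plateau from [p] to [q], portion from
    [q] to [b]. The ends of a stretch may coincide; for the gap this means a loop. *)
Record portion_split (R : realType) (f : R -> R) (a b lo hi : R)
    (u v p q glo ghi : R) : Prop := PortionSplit {
  split_levels : [/\ f u = f a, f v = f a, f p = f a & f q = f a];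
  split_inside : [/\ lo < u < hi, lo < v < hi, lo < p < hi & lo < q < hi];
  split_half : [/\ `|u - a| <= `|b - a| / 2, `|p - v| <= `|b - a| / 2 &
    `|b - q| <= `|b - a| / 2];
  split_left : escapable f a u /\ escapable f u a;
  split_mid : escapable f v p /\ escapable f p v;
  split_right : escapable f q b /\ escapable f b q;
  split_plateau : forall x, p <= x <= q \/ q <= x <= p -> f x = f a;
  split_gap : [/\ lo <= glo, ghi <= hi & glo < ghi];
  split_gap_ends : (u = glo \/ u = ghi) /\ (v = glo \/ v = ghi);
  split_gap_avoids : forall x, glo < x -> x < ghi -> f x <> f a }.

Lemma portion_split_flip (R : realType) (f : R -> R)
    (a b lo hi u v p q glo ghi : R) :
  portion_split (fun x => f (- x)) a b lo hi u v p q glo ghi ->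
  portion_split f (- a) (- b) (- hi) (- lo) (- u) (- v) (- p) (- q)
    (- ghi) (- glo).
Proof.
have dN (x y : R) : `|- x - - y| = `|x - y| by rewrite -opprD normrN.
case=> fE [/andP[? ?] /andP[? ?] /andP[? ?] /andP[? ?]] half.
move=> [/escapable_flip ? /escapable_flip ?] [/escapable_flip ? /escapable_flip ?].
move=> [/escapable_flip ? /escapable_flip ?] pl [? ? ?] [ue ve] av.
split=> //.
- by split; apply/andP; split; lra.
- by rewrite !dN.
- by move=> x H; rewrite -[x]opprK; apply: pl; case: H => /andP[? ?];
    [right|left]; apply/andP; split; lra.
- by split; lra.
- by split; [case: ue|case: ve] => ->; [right|left|right|left].
- by move=> x ? ?; rewrite -[x]opprK; apply: av; lra.
Qed.

(** For distinct ends, only the side on which the other end lies matters. *)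
Lemma escapable_nondeg (R : realType) (f : R -> R) (u v w : R) :
  escapable f u v -> u < v -> u < w -> escapable f u w.
Proof.
case=> [?|?|[_ H]|[vu _]] uv uw; [exact: Or41|exact: Or42| |lra].
by apply: Or43.
Qed.

Lemma escapable_nondegl (R : realType) (f : R -> R) (u v w : R) :
  escapable f u v -> v < u -> w < u -> escapable f u w.
Proof.
case=> [?|?|[vu _]|[_ H]] uv uw; [exact: Or41|exact: Or42|lra| ].
by apply: Or44.
Qed.

(** A plateau to the right of [a] contradicts both [avoids_right] and the accumulation of other
    values from the right. *)
Lemma escapable_plateau_right (R : realType) (f : R -> R) (a b m : R) :
  escapable f a b -> a < b -> a < m ->
  (forall x, a <= x -> x <= m -> f x = f a) -> avoids_left f a.
Proof.
case=> [//|[d d0 H]|[_ H]|[ba _]] ab am pl; last by lra.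
  pose y := Num.min m (a + d / 2).
  have ym : y <= m by rewrite ge_min lexx.
  have yd : y <= a + d / 2 by rewrite ge_min lexx orbT.
  have ys : a < y by rewrite lt_min am; lra.
  by case: (H y ys _ (pl _ (ltW ys) ym)); lra.
by have [x [ax xm []]] := H _ am; apply: pl; apply: ltW.
Qed.

Lemma escapable_plateau_left (R : realType) (f : R -> R) (a b m : R) :
  escapable f b a -> a < b -> m < b ->
  (forall x, m <= x -> x <= b -> f x = f b) -> avoids_right f b.
Proof.
move=> eb ab mb pl.
rewrite -[b]opprK; apply: avoids_left_flip.
apply: (@escapable_plateau_right _ _ _ (- a) (- m)); [|lra|lra|].
  by apply: escapable_flip; under eq_fun do rewrite opprK.
by move=> x bx xm; rewrite opprK; apply: pl; lra.
Qed.

(* The midpoint [m] either lies in a gap of the level set of [f a], or in a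
   maximal plateau [[p, q]] of it; in both cases what is left over on each side
   has at most half the length of [[a, b]]. *)
Lemma portion_split_le (R : realType) (f : R -> R) (a b lo hi : R) :
  continuous f -> a <= b -> lo < a -> b < hi -> f b = f a ->
  escapable f a b -> escapable f b a ->
  exists u v p q glo ghi, portion_split f a b lo hi u v p q glo ghi.
Proof.
move=> cf ab loa bhi fba ea eb.
have abE : `|b - a| = b - a by rewrite ger0_norm; lra.
have normle (x y e : R) : x - y <= e -> y - x <= e -> `|x - y| <= e.
  by move=> ? ?; rewrite ler_norml; apply/andP; split; lra.
(* A degenerate portion: all cut points are [a], and the gap is a loop at [a]. *)
have [aEb|aneb] := eqVneq a b.
  subst b.
  have [glo [ghi [g1 g2 g3 g4 g5]]] := small_loop (escapable_self ea) loa bhi.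
  exists a, a, a, a, glo, ghi; split=> //.
  - by split; apply/andP; split.
  - by rewrite subrr normr0; split; lra.
  - move=> x [] /andP[ax xa]; congr f; lra.
have {}ab : a < b by rewrite lt_neqAle aneb.
pose m := (a + b) / 2.
have am : a < m by rewrite /m; lra.
have mb : m < b by rewrite /m; lra.
(* If [m] is off the level, the gap is the interval from [u] to [v] around [m], and the plateau
   degenerates to [v]. *)
have [fm|fm] := pselect (f m = f a); last first.
  have [u [au um fu Hu]] := last_hit cf (ltW am) erefl fm.
  have [v [mv vb fv Hv]] := first_hit cf (ltW mb) fba fm.
  have gap x : u < x -> x < v -> f x <> f a.
    by move=> ux xv; case: (leP x m) => xm; [apply: Hu|apply: Hv => //; apply: ltW].
  have eu : avoids_right f u.
    by exists (v - u) => [|x ux xd]; [lra|rewrite fu; apply: gap; lra].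
  have ev : avoids_left f v.
    by exists (v - u) => [|x ux xd]; [lra|rewrite fv; apply: gap; lra].
  exists u, v, v, v, u, v; split=> //.
  - by split; apply/andP; split; lra.
  - by rewrite abE subrr normr0; split; [apply: normle| |apply: normle];
      move: um mv; rewrite /m; lra.
  - split; last exact: Or42.
    have [uE|une] := eqVneq u a; first by rewrite -uE; exact: Or42.
    apply: escapable_nondeg ea _ _ => //.
    by rewrite lt_neqAle eq_sym une.
  - by split; exact: Or41.
  - split; first exact: Or41.
    have [uE|une] := eqVneq v b; first by rewrite -uE; exact: Or41.
    apply: escapable_nondegl eb _ _ => //.
    by rewrite lt_neqAle une.
  - by move=> x [] /andP[ax xa]; rewrite -fv; congr f; lra.
  - by split; lra.
  - by split; [left|right].
have [p [ap pm plp Hp]] := plateau_left cf (ltW am) erefl fm.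
have [q [mq qb plq Hq]] := plateau_right cf (ltW mb) fba fm.
have fp : f p = f a by apply: plp.
have fq : f q = f a by apply: plq.
have pl x : p <= x -> x <= q -> f x = f a.
  by move=> px xq; case: (leP x m) => xm; [apply: plp|apply: plq => //; apply: ltW].
have eqb : escapable f q b /\ escapable f b q.
  have [qE|qne] := eqVneq q b.
    suff: avoids_right f b by move=> H; rewrite qE; split; exact: Or42.
    apply: escapable_plateau_left eb ab mb _ => x mx xb.
    by rewrite fba; apply: plq => //; rewrite qE.
  have {}qb : q < b by rewrite lt_neqAle qne.
  split; last by apply: escapable_nondegl eb ab qb.
  apply: Or43; split => // y /(Hq qb)[x [qx xy fx]].
  by exists x; rewrite fq.
have plat x : p <= x <= q \/ q <= x <= p -> f x = f a.
  by case=> /andP[? ?]; apply: pl; lra.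
(* If the plateau starts at [a], nothing is left over on its left, and the gap becomes a loop to the
   left of [a]. *)
have [pE|pne] := eqVneq p a.
  have la : avoids_left f a.
    apply: escapable_plateau_right ea ab am _ => x ax xm.
    by apply: plp => //; rewrite pE.
  have [glo [ghi [g1 g2 g3 g4 g5]]] :=
    small_loop (or_introl la) loa (lt_trans ab bhi).
  exists a, a, p, q, glo, ghi; split=> //.
  - by split; apply/andP; split; lra.
  - rewrite abE pE subrr normr0; split; [lra|lra|apply: normle].
      by move: mq; rewrite /m; lra.
    lra.
  - by split; exact: Or41.
  - by rewrite pE; split; exact: Or41.
have {}ap : a < p by rewrite lt_neqAle eq_sym pne.
(* Otherwise there is a point off the level between [a] and [p]; the interval around it serves as
   the gap. *)
have [x [ax xp fx]] := Hp ap a ap.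
have [u [au ux fu Hu]] := last_hit cf (ltW ax) erefl fx.
have [v [xv vp fv Hv]] := first_hit cf (ltW xp) fp fx.
have gap y : u < y -> y < v -> f y <> f a.
  by move=> uy yv; case: (leP y x) => yx; [apply: Hu|apply: Hv => //; apply: ltW].
have eu : avoids_right f u.
  by exists (v - u) => [|y uy yd]; [lra|rewrite fu; apply: gap; lra].
have ev : avoids_left f v.
  by exists (v - u) => [|y uy yd]; [lra|rewrite fv; apply: gap; lra].
exists u, v, p, q, u, v; split=> //.
- by split; apply/andP; split; lra.
- by rewrite abE; split; apply: normle; move: pm mq; rewrite /m; lra.
- split; last exact: Or42.
  have [uE|une] := eqVneq u a; first by rewrite -uE; exact: Or42.
  apply: escapable_nondeg ea _ _ => //.
  by rewrite lt_neqAle eq_sym une.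
- split; first exact: Or41.
  have [vE|vne] := eqVneq v p; first by rewrite -vE; exact: Or41.
  have vltp : v < p by rewrite lt_neqAle vne.
  apply: Or44; split => // y /(Hp ap)[z [yz zp fz]].
  by exists z; rewrite fp.
- by split; lra.
- by split; [left|right].
Qed.

Lemma portion_split_exists (R : realType) (f : R -> R) (a b lo hi : R) :
  continuous f -> lo < a < hi -> lo < b < hi -> f b = f a ->
  escapable f a b -> escapable f b a ->
  exists u v p q glo ghi, portion_split f a b lo hi u v p q glo ghi.
Proof.
move=> cf /andP[? ?] /andP[? ?] fba ea eb.
have [ab|ba] := leP a b; first exact: portion_split_le.
have [|||||||u [v [p [q [glo [ghi H]]]]]] := @portion_split_le R
  (fun x => f (- x)) (- a) (- b) (- hi) (- lo).
- exact: continuous_flip.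
- lra.
- lra.
- lra.
- by rewrite !opprK.
- by apply: escapable_flip; under eq_fun do rewrite opprK.
- by apply: escapable_flip; under eq_fun do rewrite opprK.
have {}H := portion_split_flip H; rewrite !opprK in H.
by exists (- u), (- v), (- p), (- q), (- ghi), (- glo).
Qed.

(** * The automaton of kinds *)

(* [true] stands for red (rational values), [false] for blue.  The level of a
   [Portion] or [Plateau] is shared by both ends of the cell; [Gap c1 c2] is a
   stretch on which the levels of its ends, of colors [c1] and [c2], are
   avoided. *)
Inductive kind := Gap of bool & bool | Portion of bool | Plateau of bool.

(** Red is picked only between two blue ends, so a gap that picks red has no red value at its
    ends. *)
Definition next_color (c1 c2 : bool) := ~~ (c1 || c2).

Definition child (K : kind) (j : nat) : kind :=
  match K, j with
  | Gap c1 c2, 0%N => Gap c1 (next_color c1 c2)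
  | Gap c1 c2, 1%N | Gap c1 c2, 3%N => Portion (next_color c1 c2)
  | Gap c1 c2, 2%N => Plateau (next_color c1 c2)
  | Gap c1 c2, _ => Gap (next_color c1 c2) c2
  | Portion c, 1%N => Gap c c
  | Portion c, 3%N => Plateau c
  | Portion c, _ => Portion c
  | Plateau c, _ => Plateau c
  end.

(** [cnt c] counts the levels of color [c] already dealt with; it is also the index of the next one
    to be taken. *)
Definition new_count (K : kind) (cnt : bool -> nat) : bool -> nat :=
  if K is Gap c1 c2 then fun c => (cnt c + (c == next_color c1 c2))%N else cnt.

Definition is_gap (K : kind) := if K is Gap _ _ then true else false.

Definition shrinking (K K' : kind) :=
  match K, K' with
  | Portion _, Portion _ | Plateau _, Plateau _ => true
  | _, _ => false
  end.

(* The image of a cell: its left end goes to [pa], its right end to [pb], and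
   the cell stays inside [[plo, phi]].  A gap with [pa = pb] is a loop: the path
   enters [[plo, phi]] at one end and comes back. *)
Record piece (R : realType) := Piece { pa : R; pb : R; plo : R; phi : R }.

(** * Pieces of the path and their refinement into five *)

Section Pieces.
Variables (R : realType) (f : R -> R) (E : bool -> nat -> R).

Definition level (c : bool) (y : R) := exists i, y = E c i.

(** The ends of a portion lie strictly inside its box, which leaves room for loops beside them. *)
Definition fits (K : kind) (d : piece R) : Prop :=
  let: Piece a b lo hi := d in
  match K with
  | Gap c1 c2 => [/\ lo < hi, (a = lo \/ a = hi) /\ (b = lo \/ b = hi),
      forall x, lo < x < hi -> f x <> f a, forall x, lo < x < hi -> f x <> f b &
      level c1 (f a) /\ level c2 (f b)]
  | Portion c => [/\ lo < a < hi, lo < b < hi, f b = f a, level c (f a) &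
      escapable f a b /\ escapable f b a]
  | Plateau c => [/\ lo <= a <= hi, lo <= b <= hi, level c (f a) &
      forall x, lo <= x <= hi -> f x = f a]
  end.

(** The own level of the piece is excepted because portions and plateaus lie on it. In a gap [fits]
    makes the exception void. *)
Definition avoids (cnt : bool -> nat) (d : piece R) : Prop :=
  forall x c i, plo d < x < phi d -> (i < cnt c)%N -> f x = E c i ->
    f x = f (pa d).

Definition valid (K : kind) (cnt : bool -> nat) (d : piece R) : Prop :=
  fits K d /\ avoids cnt d.

Definition width (d : piece R) := phi d - plo d.

(** By [ref_inside], the children of a gap touch the boundary of its box only at [pa] and [pb],
    whose levels have known colors. *)
Record refines (K : kind) (cnt : bool -> nat) (d : piece R)
    (F : nat -> piece R) : Prop := Refines {
  ref_valid : forall j, (j < 5)%N -> valid (child K j) (new_count K cnt) (F j);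
  ref_nested : forall j, (j < 5)%N -> plo d <= plo (F j) /\ phi (F j) <= phi d;
  ref_first : pa (F 0) = pa d;
  ref_last : pb (F 4) = pb d;
  ref_link : forall j, (j < 4)%N -> pb (F j) = pa (F j.+1);
  ref_shrink : forall j, (j < 5)%N -> shrinking K (child K j) ->
    width (F j) <= 3 / 4 * width d;
  ref_level : forall j, (j < 5)%N -> ~~ is_gap K -> f (pa (F j)) = f (pa d);
  ref_inside : forall j, (j < 5)%N -> is_gap K ->
    forall y, plo (F j) <= y <= phi (F j) ->
      [\/ plo d < y < phi d, y = pa d | y = pb d] }.

Hypothesis cf : continuous f.

Lemma constant_ends (lo hi v : R) : lo < hi ->
  (forall x, lo < x < hi -> f x = v) -> f lo = v /\ f hi = v.
Proof.
move=> lohi H; split; apply: contrapT => /(continuous_neq cf)[d d0 Hd].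
  pose x := Num.min ((lo + hi) / 2) (lo + d / 2).
  have x1 : x <= (lo + hi) / 2 by rewrite ge_min lexx.
  have x2 : x <= lo + d / 2 by rewrite ge_min lexx orbT.
  have x3 : lo < x by rewrite lt_min; apply/andP; split; lra.
  apply: (Hd x); first by rewrite ltr_norml; apply/andP; split; lra.
  by apply: H; rewrite x3; lra.
pose x := Num.max ((lo + hi) / 2) (hi - d / 2).
have x1 : (lo + hi) / 2 <= x by rewrite le_max lexx.
have x2 : hi - d / 2 <= x by rewrite le_max lexx orbT.
have x3 : x < hi by rewrite gt_max; apply/andP; split; lra.
apply: (Hd x); first by rewrite ltr_norml; apply/andP; split; lra.
by apply: H; rewrite x3; lra.
Qed.

(** Each side is widened by at most an eighth of [hi - lo]. For portions this quarter and the half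
    from the splitting give the factor 3/4 of [ref_shrink]. *)
Lemma hull_exists (c d lo hi : R) : lo < c < hi -> lo < d < hi ->
  exists lo' hi', [/\ lo < lo' /\ hi' < hi, lo' < c < hi', lo' < d < hi' &
    hi' - lo' <= `|c - d| + (hi - lo) / 4].
Proof.
wlog cd : c d / c <= d.
  move=> H c1 d1; case: (leP c d) => [|/ltW] cd; first exact: H.
  have [lo' [hi' [? ? ? ?]]] := H d c cd d1 c1.
  by exists lo', hi'; rewrite distrC.
move=> /andP[c1 c2] /andP[d1 d2].
rewrite (ler0_norm (_ : c - d <= 0)) ?subr_le0 //.
pose lo' := Num.max ((lo + c) / 2) (c - (hi - lo) / 8).
pose hi' := Num.min ((hi + d) / 2) (d + (hi - lo) / 8).
have l1 : (lo + c) / 2 <= lo' by rewrite le_max lexx.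
have l2 : c - (hi - lo) / 8 <= lo' by rewrite le_max lexx orbT.
have l3 : lo' < c by rewrite gt_max; apply/andP; split; lra.
have h1 : hi' <= (hi + d) / 2 by rewrite ge_min lexx.
have h2 : hi' <= d + (hi - lo) / 8 by rewrite ge_min lexx orbT.
have h3 : d < hi' by rewrite lt_min; apply/andP; split; lra.
clearbody lo' hi'.
by exists lo', hi'; split; [split| apply/andP; split| apply/andP; split|]; lra.
Qed.

Lemma refines_plateau (c : bool) (cnt : bool -> nat) (d : piece R) :
  valid (Plateau c) cnt d -> exists F, refines (Plateau c) cnt d F.
Proof.
case: d => a b lo hi [] [/andP[a1 a2] /andP[b1 b2] la H] av.
pose e j := a + j%:R * ((b - a) / 5).
have eE j : (j <= 5)%N -> lo <= e j <= hi.
  move=> j5; rewrite /e.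
  have -> : a + j%:R * ((b - a) / 5) = (1 - j%:R / 5) * a + (j%:R / 5) * b by field.
  have j0 : 0 <= j%:R / 5 :> R by rewrite divr_ge0.
  have j1 : j%:R / 5 <= 1 :> R by rewrite ler_pdivrMr // mul1r ler_nat.
  by apply/andP; split; nra.
pose F j := Piece (e j) (e j.+1) (Num.min (e j) (e j.+1)) (Num.max (e j) (e j.+1)).
have eS j : e j.+1 = e j + (b - a) / 5 by rewrite /e -natr1 mulrDl mul1r addrA.
exists F; split=> //=.
- move=> j j5; have /andP[e1 e2] := eE j (ltnW j5).
  have /andP[e3 e4] := eE _ j5.
  have K x : Num.min (e j) (e j.+1) <= x <= Num.max (e j) (e j.+1) -> f x = f a.
    by move=> /andP[x1 x2]; apply: H; apply/andP; split;
      [apply: le_trans x1; rewrite le_min e1 e3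
      |apply: (le_trans x2); rewrite ge_max e2 e4].
  have Ke : f (e j) = f a by apply: H; rewrite e1.
  split; last by move=> x c' i /= /andP[x1 x2] _ _; rewrite Ke; apply: K; rewrite !ltW.
  split; rewrite ?ge_min ?le_max ?lexx ?orbT // ?Ke //.
- move=> j j5; have /andP[e1 e2] := eE j (ltnW j5).
  have /andP[e3 e4] := eE _ j5.
  by split; [rewrite le_min e1|rewrite ge_max e2].
- by rewrite /e mul0r addr0.
- by rewrite /e; field.
- move=> j j5 _; rewrite /width /= eS.
  by case: (leP (e j) (e j + (b - a) / 5)); lra.
- by move=> j j5 _; apply: H; apply: eE; apply: ltnW.
Qed.

Lemma refines_portion (c : bool) (cnt : bool -> nat) (d : piece R) :
  valid (Portion c) cnt d -> exists F, refines (Portion c) cnt d F.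
Proof.
case: d => a b lo hi [] /= [ia ib fba la [ea eb]] av.
have [u [v [p [q [glo [ghi S]]]]]] := portion_split_exists cf ia ib fba ea eb.
case: S => -[fu fv fp fq] [iu iv ip iq] [h1 h2 h3] [e1 e2] [e3 e4] [e5 e6].
move=> pl [g1 g2 g3] [gu gv] gav.
have ba : `|b - a| <= hi - lo.
  by move: ia ib => /andP[? ?] /andP[? ?]; rewrite ler_norml; apply/andP; split; lra.
have [l0 [r0 [[n01 n02] m01 m02 w0]]] := hull_exists ia iu.
have [l2 [r2 [[n21 n22] m21 m22 w2]]] := hull_exists iv ip.
have [l4 [r4 [[n41 n42] m41 m42 w4]]] := hull_exists iq ib.
pose F := nth (Piece q b l4 r4) [:: Piece a u l0 r0; Piece u v glo ghi;
  Piece v p l2 r2; Piece p q (Num.min p q) (Num.max p q)].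
have loF j : (j < 5)%N -> lo <= plo (F j) /\ phi (F j) <= hi.
  case: j => [|[|[|[|[|//]]]]] _ /=; rewrite ?(ltW n01) ?(ltW n02) ?(ltW n21)
    ?(ltW n22) ?(ltW n41) ?(ltW n42) //.
  move: ip iq => /andP[p1 p2] /andP[q1 q2].
  by rewrite le_min ge_max (ltW p1) (ltW p2) (ltW q1) (ltW q2).
have faF j : (j < 5)%N -> f (pa (F j)) = f a by case: j => [|[|[|[|[|//]]]]].
exists F; split=> //=.
- move=> j j5; split; last first.
    move=> x c' i /andP[x1 x2] ic' fx; rewrite faF //; apply: av ic' fx => /=.
    have [? ?] := loF _ j5; apply/andP; split.
      by apply: le_lt_trans x1.
    by apply: (lt_le_trans x2).
  case: j j5 => [|[|[|[|[|//]]]]] _ /=.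
  + by split=> //; rewrite fu.
  + by rewrite fu fv; split => // x /andP[]; exact: gav.
  + by split; rewrite ?fv ?fp.
  + rewrite fp; split=> //; rewrite ?ge_min ?le_max ?lexx ?orbT // => x.
    by case: (leP p q) => ? /andP[? ?]; apply: pl; [left|right]; apply/andP.
  + by split; rewrite ?fq.
- by case=> [|[|[|[|//]]]].
- rewrite /width /=; case=> [|[|[|[|[|//]]]]] //= _ _.
  + by apply: (le_trans w0); rewrite distrC; lra.
  + by apply: (le_trans w2); rewrite distrC; lra.
  + by apply: (le_trans w4); rewrite distrC; lra.
- by move=> j j5 _; exact: faF.
Qed.

Hypothesis Edense : forall c x y, x < y -> exists i, x < E c i < y.

Lemma level_between (lo hi x y : R) (c : bool) :
  lo < x < hi -> lo < y < hi -> f x <> f y ->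
  exists i, exists2 z, lo < z < hi & f z = E c i.
Proof.
wlog xy : x y / x < y.
  move=> H xi yi fxy; case: (ltgtP x y) => [xy|xy|xy].
  - exact: (H x y).
  - by apply: (H y x) => // /esym.
  - by rewrite xy in fxy.
move=> /andP[x1 x2] /andP[y1 y2] /eqP fxy.
have [i /andP[i1 i2]] : exists i, Num.min (f x) (f y) < E c i < Num.max (f x) (f y).
  by apply: Edense; move: fxy; case: (ltgtP (f x) (f y)).
have [||z] := @IVT R f x y (E c i) (ltW xy).
- exact: continuous_subspaceT.
- by rewrite !ltW.
rewrite in_itv /= => /andP[z1 z2] fz.
by exists i, z => //; apply/andP; split; lra.
Qed.

(* Taking the [k]-th level of the color whenever it is attained makes sure that
   every level is eventually avoided. *)
Lemma pick_level (lo hi : R) (c : bool) (k : nat) :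
  lo < hi -> (forall x, lo < x < hi -> f x <> f lo) \/
             (forall x, lo < x < hi -> f x <> f hi) ->
  exists x0, [/\ lo < x0 < hi, level c (f x0) &
    forall x, lo < x < hi -> f x = E c k -> f x0 = E c k].
Proof.
move=> lohi H.
have [[x xi fx]|nx] := pselect (exists2 x, lo < x < hi & f x = E c k).
  by exists x; split => //; exists k.
have m : lo < (lo + hi) / 2 < hi by apply/andP; split; lra.
have [[x xi fx]|cst] :=
    pselect (exists2 x, lo < x < hi & f x <> f ((lo + hi) / 2)); last first.
  (* A constant [f] would take inside the value at [lo] or [hi] that is avoided there. *)
  have [|flo fhi] := @constant_ends lo hi (f ((lo + hi) / 2)) lohi.
    by move=> x xi; apply: contrapT => fx; apply: cst; exists x.
  by case: H => /(_ _ m) []; rewrite ?flo ?fhi.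
have [i [z zi fz]] := level_between c xi m fx.
by exists z; split => //; [exists i|move=> y yi fy; case: nx; exists y].
Qed.

(** [x] is the first point of level [g] on the way from [a] into the gap. The stretch between them
    becomes a new gap and provides a side of [x] on which [f] avoids [g], so loops at [x] are
    possible. *)
Lemma gap_hit (a lo hi x0 g : R) :
  (a = lo \/ a = hi) -> lo < x0 < hi -> f x0 = g -> f a <> g ->
  exists x glo ghi, [/\ lo < x < hi /\ f x = g,
    lo <= glo /\ ghi <= hi,
    glo < ghi /\ ((a = glo /\ x = ghi) \/ (a = ghi /\ x = glo)),
    (forall y, glo < y < ghi -> f y <> g) &
    avoids_left f x \/ avoids_right f x].
Proof.
move=> [->|->] /andP[x1 x2] fx0 fa.
  have [v [lv vx fv Hv]] := first_hit cf (ltW x1) fx0 fa.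
  exists v, lo, v; split; [split=> //; lra|split; lra|by split=> //; left| |].
    by move=> y /andP[y1 y2]; apply: Hv => //; apply: ltW.
  left; exists (v - lo) => [|y y1 y2]; first lra.
  by rewrite fv; apply: Hv => //; lra.
have [v [xv vh fv Hv]] := last_hit cf (ltW x2) fx0 fa.
exists v, v, hi; split; [split=> //; lra|split; lra|by split=> //; right| |].
  by move=> y /andP[y1 y2]; apply: Hv => //; apply: ltW.
right; exists (hi - v) => [|y y1 y2]; first lra.
by rewrite fv; apply: Hv => //; lra.
Qed.

Lemma gap_hit_inside (a x lo hi glo ghi y : R) : lo < x < hi -> lo <= glo ->
  ghi <= hi -> (a = glo /\ x = ghi) \/ (a = ghi /\ x = glo) ->
  a = lo \/ a = hi -> glo <= y <= ghi -> lo < y < hi \/ y = a.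
Proof.
move=> /andP[x1 x2] g1 g2 ge ae /andP[y1 y2].
have [->|ya] := eqVneq y a; [by right|left].
case: ge => -[aE xE]; rewrite -aE -xE in g1 g2 y1 y2.
  have ay : a < y by rewrite lt_neqAle eq_sym ya.
  by rewrite (le_lt_trans g1 ay) (le_lt_trans y2 x2).
have {}ya : y < a by rewrite lt_neqAle ya.
by rewrite (lt_le_trans x1 y1) (lt_le_trans ya g2).
Qed.

(** The path runs from [a] to the first point [x] of the new level, then along this level to [z],
    the first point seen from [b], and on to [b]. The plateau and the second portion are degenerate
    at [z]. *)
Lemma refines_gap (c1 c2 : bool) (cnt : bool -> nat) (d : piece R) :
  valid (Gap c1 c2) cnt d -> exists F, refines (Gap c1 c2) cnt d F.
Proof.
case: d => a b lo hi [] /= [lohi [ae be] fa fb [la lb]] av.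
have [|x0 [x0i [i0 lx0] hx0]] := @pick_level lo hi (next_color c1 c2) (cnt (next_color c1 c2)) lohi.
  by case: ae => aE; rewrite aE in fa; [left|right].
set g := f x0 in lx0 hx0.
have [x [glo [ghi [[xi fx] [g1 g2] [g3 ge] gav xe]]]] :=
  gap_hit ae x0i (erefl g) (nesym (fa _ x0i)).
have [z [hlo [hhi [[zi fz] [h1 h2] [h3 he] hav ze]]]] :=
  gap_hit be x0i (erefl g) (nesym (fb _ x0i)).
have [l1 [r1 [[n11 n12] m11 m12 w1]]] := hull_exists xi zi.
have [l3 [r3 [[n31 n32] m31 m32 w3]]] := hull_exists zi zi.
have ez : escapable f z z by case: ze => ?; [apply: Or41|apply: Or42].
have exz : escapable f x z by case: xe => ?; [apply: Or41|apply: Or42].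
have ezx : escapable f z x by case: ze => ?; [apply: Or41|apply: Or42].
have lg : level (next_color c1 c2) g by exists i0.
pose F := nth (Piece z b hlo hhi) [:: Piece a x glo ghi; Piece x z l1 r1;
  Piece z z z z; Piece z z l3 r3].
have loF j : (j < 5)%N -> lo <= plo (F j) /\ phi (F j) <= hi.
  case: j => [|[|[|[|[|//]]]]] _ /=; rewrite ?(ltW n11) ?(ltW n12) ?(ltW n31)
    ?(ltW n32) //.
  by move: zi => /andP[z1 z2]; rewrite !ltW.
(* Below the new count are the old indices, whose levels the gap avoids, and one further index,
   whose level is [g] if it is attained at all. *)
have avF y c i : lo < y < hi -> (i < new_count (Gap c1 c2) cnt c)%N -> f y = E c i -> f y = g.
  move=> yi /=; rewrite addnC; case: eqP => [->|_] /=; last first.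
    by rewrite add0n => ic fy; case: (fa _ yi); apply: av ic fy.
  rewrite add1n ltnS leq_eqVlt => /predU1P[->|ic] fy.
    by rewrite fy; apply/esym/(hx0 _ yi fy).
  by case: (fa _ yi); apply: av ic fy.
exists F; split=> //=.
- move=> j j5; split; last first.
    move=> y c' i /andP[y1 y2] ic' fy.
    have [s1 s2] := loF _ j5.
    have yi : lo < y < hi.
      by apply/andP; split; [apply: le_lt_trans y1|apply: lt_le_trans s2].
    have gy := avF _ _ _ yi ic' fy.
    case: j j5 y1 y2 {s1 s2} => [|[|[|[|[|//]]]]] _ /= y1 y2;
      rewrite ?fx ?fz //.
    by case: (gav y) => //; rewrite y1.
  have sub (lo' hi' : R) : lo <= lo' -> hi' <= hi -> forall y, lo' < y < hi' -> lo < y < hi.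
    by move=> s1 s2 y /andP[y1 y2]; apply/andP; split; [apply: le_lt_trans y1|apply: lt_le_trans s2].
  case: j j5 => [|[|[|[|[|//]]]]] _ /=; rewrite ?fx ?fz.
  + split=> //; last by move=> y yi; apply: fa; apply: sub yi.
    by case: ge => -[-> ->]; split; [left|right|right|left].
  + by split.
  + by split => //; rewrite ?lexx // => y /le_anti <-; rewrite fz.
  + by split.
  + split=> //; last by move=> y yi; apply: fb; apply: sub yi.
    by case: he => -[-> ->]; split; [right|left|left|right].
- by case=> [|[|[|[|//]]]].
- move=> j j5 _ y.
  have inside (l r : R) : lo < l -> r < hi -> l <= y <= r -> lo < y < hi.
    move=> ll rh /andP[y1 y2].
    by rewrite (lt_le_trans ll y1) (le_lt_trans y2 rh).
  case: j j5 => [|[|[|[|[|//]]]]] _ /= yi.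
  + by case: (gap_hit_inside xi g1 g2 ge ae yi) => ?; [exact: Or31|exact: Or32].
  + by apply: Or31; apply: inside yi.
  + by apply: Or31; move: zi => /andP[? ?]; apply: inside yi.
  + by apply: Or31; apply: inside yi.
  + by case: (gap_hit_inside zi h1 h2 he be yi) => ?; [exact: Or31|exact: Or33].
Qed.

Lemma refines_exists (K : kind) (cnt : bool -> nat) (d : piece R) :
  valid K cnt d -> exists F, refines K cnt d F.
Proof.
by case: K => [c1 c2|c|c];
  [exact: refines_gap|exact: refines_portion|exact: refines_plateau].
Qed.

End Pieces.

(** * Infinite runs of the automaton *)

Section Runs.
Variables (T : nat -> kind) (dg : nat -> nat) (cnt : nat -> bool -> nat).
Hypothesis Tchild : forall n, T n.+1 = child (T n) (dg n).
Hypothesis cntS : forall n, cnt n.+1 = new_count (T n) (cnt n).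
Hypothesis dg5 : forall n, (dg n < 5)%N.

Definition infinitely (P : nat -> Prop) :=
  forall N, exists2 n, (N <= n)%N & P n.

Lemma not_infinitely (P : nat -> Prop) :
  ~ infinitely P -> exists N, forall n, (N <= n)%N -> ~ P n.
Proof.
move=> H; apply: contrapT => H'; apply: H => N; apply: contrapT => H''.
by apply: H'; exists N => n Nn Pn; apply: H''; exists n.
Qed.

Lemma from_on (P : nat -> Prop) (N : nat) : P N ->
  (forall n, (N <= n)%N -> P n -> P n.+1) -> forall n, (N <= n)%N -> P n.
Proof.
move=> PN PS; elim=> [|n IH]; first by rewrite leqn0 => /eqP <-.
by rewrite leq_eqVlt => /predU1P[<-//|Nn]; apply: PS => //; apply: IH.
Qed.

Lemma plateau_persists (c : bool) (n : nat) : T n = Plateau c ->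
  forall m, (n <= m)%N -> T m = Plateau c.
Proof. by move=> Tn; apply: from_on => // m nm Tm; rewrite Tchild Tm. Qed.

(** A portion becomes a gap only through its child [Gap c c], and a plateau never does. *)
Lemma gap_after_portion (c : bool) (n m : nat) : T n = Portion c ->
  (n <= m)%N -> is_gap (T m) -> exists2 k, (n <= k)%N & T k = Gap c c.
Proof.
move=> Tn nm gm; apply: contrapT => H.
have : T m = Portion c \/ T m = Plateau c.
  move: m nm {gm}; apply: from_on; first by left.
  move=> k nk [Tk|Tk]; last by right; rewrite Tchild Tk.
  have := Tchild k; rewrite Tk.
  case: (dg k) => [|[|[|[|j]]]] /= TS; try by left.
    by case: H; exists k.+1 => //; apply: leqW.
  by right.
by case=> E; rewrite E in gm.
Qed.

(** A non-shrinking step from a non-gap leads to a gap or to a plateau, and after the latter every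
    step shrinks. *)
Lemma infinitely_gaps :
  ~ infinitely (fun n => shrinking (T n) (T n.+1)) ->
  infinitely (fun n => is_gap (T n)).
Proof.
move=> /not_infinitely[N HN] M.
set n := maxn M N.
have Mn : (M <= n)%N by apply: leq_maxl.
have Nn : (N <= n)%N by apply: leq_maxr.
case E : (T n) => [c1 c2|c|c]; first by exists n => //; rewrite E.
  case E' : (T n.+1) => [c1 c2|c'|c'].
  - by exists n.+1; [exact: leqW|rewrite E'].
  - by case: (HN n Nn); rewrite E E'.
  - by case: (HN n.+1 (leqW Nn)); rewrite (Tchild n.+1) E'.
by case: (HN n Nn); rewrite Tchild E.
Qed.

Definition gap_picking (c : bool) (K : kind) :=
  if K is Gap c1 c2 then next_color c1 c2 == c else false.

(** Only [Gap false false] picks red. The next gap after it has the new red level at one end or is a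
    [Gap true true] inside the red portion, so it picks blue. *)
Lemma infinitely_blue_picks : infinitely (fun n => is_gap (T n)) ->
  infinitely (fun n => gap_picking false (T n)).
Proof.
move=> H N; have [n Nn gn] := H N.
case E : (T n) gn => [c1 c2|//|//] _.
have [cc|cc] := boolP (c1 || c2).
  by exists n => //; rewrite E /= /next_color cc.
have := Tchild n; rewrite E /= /next_color (negbTE cc).
have [m nm gm] := H n.+1.
case: (dg n) => [|[|[|[|j]]]] /= TS.
- by exists n.+1; [exact: leqW|rewrite TS /= /next_color orbT].
- have [k nk Tk] := gap_after_portion TS nm gm.
  by exists k; [apply: leq_trans nk; exact: leqW|rewrite Tk].
- by rewrite (plateau_persists TS nm) in gm.
- have [k nk Tk] := gap_after_portion TS nm gm.
  by exists k; [apply: leq_trans nk; exact: leqW|rewrite Tk].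
- by exists n.+1; [exact: leqW|rewrite TS].
Qed.

Lemma count_mono (c : bool) (n m : nat) : (n <= m)%N -> (cnt n c <= cnt m c)%N.
Proof.
move: m; apply: from_on => // m nm /leq_trans; apply.
by rewrite cntS /new_count; case: (T m) => // *; rewrite leq_addr.
Qed.

Lemma count_unbounded (c : bool) :
  infinitely (fun n => gap_picking c (T n)) ->
  forall i, exists n, forall m, (n <= m)%N -> (i < cnt m c)%N.
Proof.
move=> H i.
suff [n Hn] : exists n, (i < cnt n c)%N.
  by exists n => m nm; apply: leq_trans Hn (count_mono c nm).
elim: i => [|i [n Hn]].
  have [n _ gn] := H 0%N; exists n.+1; rewrite cntS /new_count.
  by case: (T n) gn => //= c1 c2 /eqP ->; rewrite eqxx addn1.
have [m nm gm] := H n; exists m.+1; rewrite cntS /new_count.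
case: (T m) gm => //= c1 c2 /eqP ->; rewrite eqxx addn1 ltnS.
exact: leq_trans Hn (count_mono c nm).
Qed.

(** Once red is no longer picked, [Gap false false] is excluded, hence also blue portions, which
    would lead to it; blue plateaus are excluded since no gap follows them. A gap with one red end
    then has a single admissible child, the one at that end. *)
Lemma eventually_end : infinitely (fun n => is_gap (T n)) ->
  ~ infinitely (fun n => gap_picking true (T n)) ->
  exists N, (forall n, (N <= n)%N -> is_gap (T n) /\ dg n = 0%N) \/
            (forall n, (N <= n)%N -> is_gap (T n) /\ dg n = 4%N).
Proof.
move=> Hg /not_infinitely[N HN].
have nff n : (N <= n)%N -> T n <> Gap false false.
  by move=> /HN H E; apply: H; rewrite E.
have npf n : (N <= n)%N -> T n <> Portion false.
  move=> Nn E; have [m nm gm] := Hg n.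
  have [k nk /nff] := gap_after_portion E nm gm.
  by case; apply: leq_trans nk.
have nrf n : (N <= n)%N -> T n <> Plateau false.
  move=> Nn E; have [m nm] := Hg n.
  by rewrite (plateau_persists E nm).
have stepL n : (N <= n)%N -> T n = Gap true false -> T n.+1 = Gap true false /\ dg n = 0%N.
  move=> Nn E; have := Tchild n; have := dg5 n.
  rewrite E; case: (dg n) => [//|[|[|[|[|//]]]]] _ /= E'.
  - by case: (npf n.+1 (leqW Nn)).
  - by case: (nrf n.+1 (leqW Nn)).
  - by case: (npf n.+1 (leqW Nn)).
  - by case: (nff n.+1 (leqW Nn)).
have stepR n : (N <= n)%N -> T n = Gap false true -> T n.+1 = Gap false true /\ dg n = 4%N.
  move=> Nn E; have := Tchild n; have := dg5 n.
  rewrite E; case: (dg n) => [|[|[|[|[|//]]]]] _ /= E'.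
  - by case: (nff n.+1 (leqW Nn)).
  - by case: (npf n.+1 (leqW Nn)).
  - by case: (nrf n.+1 (leqW Nn)).
  - by case: (npf n.+1 (leqW Nn)).
  - by [].
have [n Nn gn] := Hg N.
have : T n.+1 = Gap true false \/ T n.+1 = Gap false true.
  case E : (T n) gn => [[] []|//|//] _.
  - have := Tchild n; rewrite E.
    case: (dg n) => [|[|[|[|j]]]] /= E'; [by left| | | |by right].
    + by case: (npf n.+1 (leqW Nn)).
    + by case: (nrf n.+1 (leqW Nn)).
    + by case: (npf n.+1 (leqW Nn)).
  - by left; case: (stepL n Nn E).
  - by right; case: (stepR n Nn E).
  - by case: (nff n Nn).
case=> E; exists n.+1; [left|right] => m nm.
- have H : T m = Gap true false.
    by move: m nm; apply: from_on => // k nk Ek; case: (stepL k (leq_trans (leqW Nn) nk) Ek).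
  by split; [rewrite H|case: (stepL m (leq_trans (leqW Nn) nm) H)].
- have H : T m = Gap false true.
    by move: m nm; apply: from_on => // k nk Ek; case: (stepR k (leq_trans (leqW Nn) nk) Ek).
  by split; [rewrite H|case: (stepR m (leq_trans (leqW Nn) nm) H)].
Qed.

Definition left_color (K : kind) :=
  match K with Gap c _ | Portion c | Plateau c => c end.

(** A late blue non-gap stays one, since its only exit is [Gap false false]. Without any, a late
    cell with blue left color is [Gap false true], whose only admissible child is the last, of the
    same kind; all later digits would be 4. *)
Lemma eventually_blue_level :
  ~ infinitely (fun n => gap_picking true (T n)) ->
  infinitely (fun n => dg n <> 4%N) ->
  infinitely (fun n => ~~ left_color (T n)) ->
  exists M, forall n, (M <= n)%N -> ~~ is_gap (T n) && ~~ left_color (T n).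
Proof.
move=> /not_infinitely[N HN] H4 Hb.
have nff n : (N <= n)%N -> T n <> Gap false false.
  by move=> /HN H E; apply: H; rewrite E.
apply: contrapT => nM.
have nlock n : (N <= n)%N -> ~~ left_color (T n) -> is_gap (T n).
  move=> Nn ln; apply: contrapT => /negP gn; apply: nM; exists n.
  apply: from_on => [|m nm /andP[gm lm]]; first by rewrite gn.
  have := nff _ (leqW (leq_trans Nn nm)); have := Tchild m.
  case: (T m) gm lm => [//|[]//|[]//] _ _; last by move=> ->.
  by case: (dg m) => [|[|[|[|j]]]] /= ->.
have [n Nn ln] := Hb N.
have step m : (N <= m)%N -> T m = Gap false true ->
    dg m = 4%N /\ T m.+1 = Gap false true.
  move=> Nm E; have := Tchild m; have := dg5 m; rewrite E.
  have := nff m.+1 (leqW Nm); have := nlock m.+1 (leqW Nm).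
  by case: (dg m) => [|[|[|[|[|//]]]]] H1 H2 _ /= E';
    rewrite E' in H1 H2 *; try (by case: H2); have := H1 isT.
have E : T n = Gap false true.
  have := nff n Nn; have := nlock n Nn ln.
  by case: (T n) ln => [[] []|//|//].
have Em : forall m, (n <= m)%N -> T m = Gap false true.
  by apply: from_on => // m nm /step[]//; exact: leq_trans nm.
have [m nm []] := H4 n.
by case: (step m (leq_trans Nn nm) (Em m nm)).
Qed.

End Runs.

(** * Chains of nested pieces: shrinking and the color of the limit value *)

Lemma nested_limits (R : realType) (lo hi : nat -> R) (e : R) : 0 < e ->
  (forall n, lo n <= lo n.+1) -> (forall n, hi n.+1 <= hi n) ->
  (forall n, lo n + e <= hi n) ->
  exists y z, [/\ y < z, forall n, lo n <= y, forall n, z <= hi n,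
    forall x, (forall n, lo n <= x) -> y <= x &
    forall x, (forall n, x <= hi n) -> x <= z].
Proof.
move=> e0 loS hiS lohi.
have loM n m : (n <= m)%N -> lo n <= lo m.
  by move: m; apply: from_on => // m _ /le_trans; apply.
have hiM n m : (n <= m)%N -> hi m <= hi n.
  by move: m; apply: from_on => // m _; apply: le_trans.
have cross n m : lo n + e <= hi m.
  apply: le_trans (_ : lo (maxn n m) + e <= _); last first.
    by apply: le_trans (lohi _) _; apply: hiM; apply: leq_maxr.
  by rewrite lerD2r; apply: loM; apply: leq_maxl.
have hlo : has_sup (range lo).
  by split; [exists (lo 0%N), 0%N|exists (hi 0%N) => _ [n _ <-]; have := cross n 0%N; lra].
have hhi : has_inf (range hi).
  by split; [exists (hi 0%N), 0%N|exists (lo 0%N) => _ [n _ <-]; have := cross 0%N n; lra].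
have supe m : sup (range lo) + e <= hi m.
  rewrite -lerBrDr; apply: ge_sup => [|_ [n _ <-]]; first by case: hlo.
  by have := cross n m; lra.
exists (sup (range lo)), (inf (range hi)); split.
- have : sup (range lo) + e <= inf (range hi).
    by apply: lb_le_inf => [|_ [n _ <-]]; [case: hhi|].
  lra.
- by move=> n; apply: sup_upper_bound => //; exists n.
- by move=> n; apply: inf_lbound; [case: hhi|exists n].
- by move=> x H; apply: ge_sup => [|_ [n _ <-]]; [case: hlo|].
- by move=> x H; apply: lb_le_inf => [|_ [n _ <-]]; [case: hhi|].
Qed.

Section Chains.
Variables (R : realType) (f : R -> R) (E : bool -> nat -> R).
Hypothesis cf : continuous f.
Hypothesis Edense : forall c x y, x < y -> exists i, x < E c i < y.
Hypothesis Edisj : forall x, level E true x -> ~ level E false x.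
Hypothesis Erat : forall r : rat,
  level E true (f (ratr r)) \/ level E false (f (ratr r)).

Lemma fits_bounds (K : kind) (d : piece R) : fits f E K d ->
  plo d <= pa d <= phi d /\ plo d <= pb d <= phi d.
Proof.
case: d K => a b lo hi [c1 c2|c|c] /=.
- by case=> lohi [[]-> []->] _ _ _; rewrite !lexx ltW.
- by case=> /andP[? ?] /andP[? ?] _ _ _; rewrite !ltW.
- by case.
Qed.

Lemma fits_level (K : kind) (d : piece R) : fits f E K d ->
  level E (left_color K) (f (pa d)).
Proof. by case: d K => a b lo hi [c1 c2|c|c] /= []// _ _ _ _ []. Qed.

Lemma width_ge0 (K : kind) (d : piece R) : fits f E K d -> 0 <= width d.
Proof.
by move=> /fits_bounds[/andP[la ah] _]; rewrite subr_ge0 (le_trans la ah).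
Qed.

Variables (T : nat -> kind) (dg : nat -> nat) (cnt : nat -> bool -> nat).
Variables (d : nat -> piece R) (F : nat -> nat -> piece R).
Hypothesis Tchild : forall n, T n.+1 = child (T n) (dg n).
Hypothesis cntS : forall n, cnt n.+1 = new_count (T n) (cnt n).
Hypothesis dg5 : forall n, (dg n < 5)%N.
Hypothesis dS : forall n, d n.+1 = F n (dg n).
Hypothesis val : forall n, valid f E (T n) (cnt n) (d n).
Hypothesis ref : forall n, refines f E (T n) (cnt n) (d n) (F n).

Lemma chain_lo (n : nat) : plo (d n) <= plo (d n.+1).
Proof. by rewrite dS; case: (ref_nested (ref n) (dg5 n)). Qed.

Lemma chain_hi (n : nat) : phi (d n.+1) <= phi (d n).
Proof. by rewrite dS; case: (ref_nested (ref n) (dg5 n)). Qed.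

Lemma chain_width (n m : nat) : (n <= m)%N -> width (d m) <= width (d n).
Proof.
move: m; apply: from_on => // m _; apply: le_trans.
by have := chain_lo m; have := chain_hi m; rewrite /width; lra.
Qed.

Lemma gap_avoids_levels (c : bool) (i n : nat) (x : R) :
  is_gap (T n) -> (i < cnt n c)%N -> plo (d n) < x < phi (d n) -> f x <> E c i.
Proof.
move=> gn ic xi fx; have [fn an] := val n.
have := an _ _ _ xi ic fx.
case: (T n) (d n) gn fn xi => [c1 c2|//|//] [a b lo hi] _ /= [_ _ H _ _].
by move=> /H.
Qed.

Lemma gaps_avoid_color (c : bool) (y z : R) :
  infinitely (fun n => is_gap (T n)) ->
  infinitely (fun n => gap_picking c (T n)) ->
  (forall n, plo (d n) <= y) -> (forall n, z <= phi (d n)) ->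
  forall x, y < x < z -> ~ level E c (f x).
Proof.
move=> Hg Hc Hy Hz x /andP[yx xz] [i fx].
have [n Hn] := count_unbounded cntS Hc i.
have [m nm gm] := Hg n.
apply: (gap_avoids_levels gm (Hn m nm) _ fx).
by rewrite (le_lt_trans (Hy m) yx) (lt_le_trans xz (Hz m)).
Qed.

Lemma gap_end (n : nat) : is_gap (T n) ->
  [/\ pa (d n) = plo (d n) \/ pa (d n) = phi (d n),
      pb (d n) = plo (d n) \/ pb (d n) = phi (d n),
      forall x, plo (d n) < x < phi (d n) -> f x <> f (pa (d n)) &
      forall x, plo (d n) < x < phi (d n) -> f x <> f (pb (d n))].
Proof.
by case: (T n) (d n) (val n) => [c1 c2|//|//] [a b lo hi] [] /= [_ [? ?] ? ? _].
Qed.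

(* A chain that shrinks only finitely often passes through infinitely many
   gaps, so on the limit interval [f] avoids all blue levels, hence is a
   constant.  Either infinitely many red levels were picked, and this constant
   is avoided too, or the chain finally follows one fixed end of its gaps, a
   point on whose level [f] does not return inside the gap. *)
Lemma chain_shrinks (e : R) : 0 < e -> exists n, width (d n) < e.
Proof.
move=> e0; apply: contrapT => H.
have we n : e <= width (d n) by rewrite leNgt; apply/negP => ?; apply: H; exists n.
have [Hs|/(infinitely_gaps Tchild) Hg] :=
    pselect (infinitely (fun n => shrinking (T n) (T n.+1))).
  (* Every shrinking step removes at least a quarter of a width that remains at least [e]; this
     cannot go on forever. *)
  have dec k : exists n, width (d n) <= width (d 0%N) - k%:R * (e / 4).
    elim: k => [|k [n Hn]]; first by exists 0%N; rewrite mul0r subr0.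
    have [m nm sm] := Hs n; exists m.+1.
    have := ref_shrink (ref m) (dg5 m); rewrite -Tchild -dS => /(_ sm).
    have := chain_width nm; have := we m; rewrite -natr1; lra.
  have [n Hn] := dec (Num.trunc (width (d 0%N) / (e / 4))).+1.
  have /truncn_itv/andP[_] : 0 <= width (d 0%N) / (e / 4).
    by rewrite divr_ge0 //; [apply: le_trans (we _); lra|lra].
  rewrite ltr_pdivrMr; last by lra.
  by have := we n; lra.
have [|||y [z [yz Hy Hz y_min z_max]]] :=
    @nested_limits R (fun n => plo (d n)) (fun n => phi (d n)) e e0.
- exact: chain_lo.
- exact: chain_hi.
- by move=> n; have := we n; rewrite /width; lra.
have Hb := infinitely_blue_picks Tchild Hg.
have nb := gaps_avoid_color Hg Hb Hy Hz.
(* The constant value of [f] on the limit interval is taken at a rational, so [Erat] makes it an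
   enumerated level. *)
have [r] := rat_in_itvoo yz; rewrite in_itv /= => ri.
have cst x : y < x < z -> f x = f (ratr r).
  move=> xi; apply: contrapT => fx.
  have [i [w wi fw]] := level_between cf Edense false xi ri fx.
  by apply: (nb w wi); exists i.
have lr : level E true (f (ratr r)) by case: (Erat r) => // /(nb _ ri).
have [Hr|Hr] := pselect (infinitely (fun n => gap_picking true (T n))).
  exact: gaps_avoid_color Hg Hr Hy Hz _ ri lr.
have [fy fz] := constant_ends cf yz cst.
(* A point that is an end of all late boxes must be [y] or [z], where [f] has the constant value by
   continuity. *)
have fixed (p : R) N : (forall n, (N <= n)%N -> p = plo (d n) \/ p = phi (d n)) ->
    f p <> f (ratr r) -> False.
  move=> Hp; apply.
  have mono n : plo (d n) <= plo (d (maxn n N)) /\ phi (d (maxn n N)) <= phi (d n).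
    elim: (maxn n N) (leq_maxl n N) => [|m IH]; first by rewrite leqn0 => /eqP ->.
    rewrite leq_eqVlt => /predU1P[->//|/IH[h1 h2]].
    by split; [apply: le_trans h1 (chain_lo m)|apply: le_trans (chain_hi m) h2].
  have yp : y <= p.
    apply: y_min => n; have [h1 h2] := mono n.
    have := we (maxn n N); rewrite /width.
    by case: (Hp _ (leq_maxr n N)) => ->; lra.
  have pz : p <= z.
    apply: z_max => n; have [h1 h2] := mono n.
    have := we (maxn n N); rewrite /width.
    by case: (Hp _ (leq_maxr n N)) => ->; lra.
  case: (Hp _ (leqnn N)) => pE.
    by have -> : p = y by apply/le_anti; rewrite yp andbT pE; exact: Hy.
  by have -> : p = z by apply/le_anti; rewrite pz pE; exact: Hz.
have [N [HN|HN]] := eventually_end Tchild dg5 Hg Hr.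
- apply: (fixed (pa (d N)) N).
    have paE : forall n, (N <= n)%N -> pa (d n) = pa (d N).
      apply: from_on => // n Nn <-; rewrite dS.
      by case: (HN n Nn) => _ ->; rewrite (ref_first (ref n)).
    by move=> n Nn; rewrite -(paE n Nn); case: (HN n Nn) => /gap_end[].
  have [/gap_end[_ _ H' _] _] := HN N (leqnn N).
  apply/nesym/H'.
  by move: ri => /andP[r1 r2]; rewrite (le_lt_trans (Hy N) r1) (lt_le_trans r2 (Hz N)).
- apply: (fixed (pb (d N)) N).
    have pbE : forall n, (N <= n)%N -> pb (d n) = pb (d N).
      apply: from_on => // n Nn <-; rewrite dS.
      by case: (HN n Nn) => _ ->; rewrite (ref_last (ref n)).
    by move=> n Nn; rewrite -(pbE n Nn); case: (HN n Nn) => /gap_end[].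
  have [/gap_end[_ _ _ H'] _] := HN N (leqnn N).
  apply/nesym/H'.
  by move: ri => /andP[r1 r2]; rewrite (le_lt_trans (Hy N) r1) (lt_le_trans r2 (Hz N)).
Qed.

Variable y : R.
Hypothesis yin : forall n, plo (d n) <= y <= phi (d n).

Lemma chain_level (N : nat) (g : R) :
  (forall n, (N <= n)%N -> f (pa (d n)) = g) -> f y = g.
Proof.
move=> H; apply: contrapT => /(continuous_neq cf)[e e0 He].
have [n wn] := chain_shrinks e0.
pose m := maxn n N.
apply: (He (pa (d m))); last by apply: H; apply: leq_maxr.
have := le_lt_trans (chain_width (leq_maxl n N)) wn.
have [/fits_bounds[/andP[a1 a2] _] _] := val m.
move: (yin m) => /andP[y1 y2]; rewrite -/m /width => w.
by rewrite ltr_norml; apply/andP; split; lra.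
Qed.

(** In a gap with red left end the new level is blue, so only child 0 has a red left end, and it
    keeps the point [pa]. Outside gaps the level does not change. *)
Lemma chain_level_step (n : nat) : left_color (T n.+1) = left_color (T n) ->
  left_color (T n) || ~~ is_gap (T n) -> f (pa (d n.+1)) = f (pa (d n)).
Proof.
rewrite dS; have := Tchild n; have := dg5 n.
case En : (T n) => [c1 c2|c|c].
- move=> d5 /= TS; rewrite orbF => lc c1t; rewrite c1t in TS lc.
  case: (dg n) d5 TS lc => [|[|[|[|[|//]]]]] _ /= ->; rewrite /next_color //=.
  by rewrite (ref_first (ref n)).
- by move=> d5 _ _ _; rewrite (ref_level (ref n)) // En.
- by move=> d5 _ _ _; rewrite (ref_level (ref n)) // En.
Qed.

Lemma chain_red : ~ infinitely (fun n => ~~ left_color (T n)) ->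
  level E true (f y).
Proof.
move=> /not_infinitely[N HN].
have red n : (N <= n)%N -> left_color (T n) by move=> /HN/negP; rewrite negbK.
rewrite (@chain_level N (f (pa (d N)))).
  by have := fits_level (proj1 (val N)); rewrite red.
apply: from_on => // n Nn <-; apply: chain_level_step; rewrite !red //.
exact: leqW.
Qed.

(** If red is picked infinitely often, some late gap that picks red avoids the supposed red value
    inside and has blue ends, which leaves no place for [y]. Otherwise the chain is locked in a blue
    level. *)
Lemma chain_blue : infinitely (fun n => dg n <> 4%N) ->
  infinitely (fun n => ~~ left_color (T n)) -> ~ level E true (f y).
Proof.
move=> H4 Hb ly.
have [Hr|Hr] := pselect (infinitely (fun n => gap_picking true (T n))).
  have [i fy] := ly; have [n Hn] := count_unbounded cntS Hr i.
  have [m nm gm] := Hr n.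
  have [] : level E true (f y) /\ ~ level E true (f y); last by [].
  split=> //; case Em : (T m) gm => [c1 c2|//|//] gm.
  have gT : is_gap (T m) by rewrite Em.
  have := @ref_inside _ _ _ _ _ _ _ (ref m) _ (dg5 m) gT y.
  rewrite -dS => /(_ (yin _))[yi|yE|yE].
  - by case: (gap_avoids_levels gT (Hn m nm) yi fy).
  - move=> ly'; apply: Edisj ly' _; rewrite yE.
    have := fits_level (proj1 (val m)); rewrite Em /=.
    by move: gm; rewrite /= /next_color; case: c1 {Em}.
  - move=> ly'; apply: Edisj ly' _; rewrite yE.
    have := proj1 (val m); rewrite Em; case: (d m) => a b lo hi /= [_ _ _ _ [_]].
    by move: gm; rewrite /= /next_color; case: c1 c2 {Em} => [] [].
have [M HM] := eventually_blue_level Tchild dg5 Hr H4 Hb.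
apply: Edisj ly _; rewrite (@chain_level M (f (pa (d M)))).
  have := fits_level (proj1 (val M)).
  by have /andP[_ /negbTE ->] := HM M (leqnn M).
apply: from_on => // n Mn <-; apply: chain_level_step.
  have /andP[_ /negbTE ->] := HM _ Mn.
  by have /andP[_ /negbTE ->] := HM _ (leqW Mn).
by have /andP[-> _] := HM _ Mn; rewrite orbT.
Qed.

End Chains.

(** * The 5-adic cells and the set [fractal] *)

(** Cell [k] of depth [n] stands for the interval from [k / 5 ^ n] to [(k + 1) / 5 ^ n]. Beyond the
    unit interval everything is blue plateau. *)
Fixpoint kind_at (n k : nat) : kind :=
  if n is m.+1 then child (kind_at m (k %/ 5)) (k %% 5)
  else if k == 0%N then Gap false false else Plateau false.

Fixpoint count_at (n k : nat) : bool -> nat :=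
  if n is m.+1 then new_count (kind_at m (k %/ 5)) (count_at m (k %/ 5))
  else fun => 0%N.

(** The absolute value folds the line, so that natural numbers suffice as indices; [fractal] is
    symmetric about 0. *)
Definition cell (R : realType) (n : nat) (t : R) : nat :=
  Num.trunc (`|t| * 5 ^+ n).

(* A point is red iff the left ends of its cells are eventually red: it is then
   trapped in a red portion or plateau, or it is the left end of a gap. *)
Definition fractal (R : realType) : set R :=
  [set t | ~ infinitely (fun n => ~~ left_color (kind_at n (cell n t)))].

Section Cells.
Variables (R : realType) (t : R).

Lemma cell_itv (n : nat) : (cell n t)%:R <= `|t| * 5 ^+ n < (cell n t).+1%:R.
Proof. by apply: truncn_itv; rewrite mulr_ge0 // exprn_ge0. Qed.

Lemma cell_div (n : nat) : (cell n.+1 t %/ 5 = cell n t)%N.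
Proof.
have /andP[a1 a2] := cell_itv n; have /andP[b1 b2] := cell_itv n.+1.
move: b1 b2; rewrite exprS mulrCA => b1 b2.
have c1 : (5 * cell n t < (cell n.+1 t).+1)%N.
  by rewrite -(ltr_nat R) natrM; lra.
have c2 : (cell n.+1 t < 5 * (cell n t).+1)%N.
  by rewrite -(ltr_nat R) natrM; lra.
lia.
Qed.

(** Cells are open on the right. If all later digits were 4, the cells would share their right end,
    at a positive distance from the absolute value of [t], while their lengths tend to 0. *)
Lemma cell_not_4 : infinitely (fun n => (cell n.+1 t %% 5)%N <> 4%N).
Proof.
apply: contrapT => /not_infinitely[N HN].
have grow k : (cell (N + k) t).+1%:R = 5 ^+ k * (cell N t).+1%:R :> R.
  elim: k => [|k IH]; first by rewrite addn0 expr0 mul1r.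
  rewrite exprS -mulrA -IH -natrM; congr _%:R.
  have := HN (N + k)%N (leq_addr _ _); have := cell_div (N + k).
  rewrite addnS; lia.
have /andP[_ c1] := cell_itv N.
pose e := (cell N t).+1%:R - `|t| * 5 ^+ N.
have e0 : 0 < e by rewrite subr_gt0.
have small k : k%:R * e <= 1.
  have /andP[c2 _] := cell_itv (N + k).
  have : 5 ^+ k * e <= 1.
    rewrite mulrBr -grow mulrCA -exprD addnC -natr1; rewrite addnC in c2 *; lra.
  apply: le_trans; rewrite ler_pM2r //.
  by rewrite -natrX ler_nat ltnW // ltn_expl.
have := small (Num.trunc e^-1).+1.
have /truncn_itv/andP[_] : 0 <= e^-1 by rewrite invr_ge0 ltW.
rewrite -(ltr_pM2r e0) mulVf ?gt_eqF //; lra.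
Qed.

End Cells.

Lemma cell_near (R : realType) (n : nat) (s t : R) : `|s - t| * 5 ^+ n < 1 ->
  [\/ cell n s = cell n t, cell n s = (cell n t).+1 | cell n t = (cell n s).+1].
Proof.
move=> H.
have /andP[a1 a2] := cell_itv s n; have /andP[b1 b2] := cell_itv t n.
have p5 : 0 < 5 ^+ n :> R by rewrite exprn_gt0.
have d1 : `|s| * 5 ^+ n - `|t| * 5 ^+ n < 1.
  by apply: le_lt_trans H; rewrite -mulrBl ler_pM2r // lerB_dist.
have d2 : `|t| * 5 ^+ n - `|s| * 5 ^+ n < 1.
  by apply: le_lt_trans H; rewrite -mulrBl ler_pM2r // distrC lerB_dist.
have c1 : (cell n s < (cell n t).+2)%N.
  by rewrite -(ltr_nat R) -natr1; lra.
have c2 : (cell n t < (cell n s).+2)%N.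
  by rewrite -(ltr_nat R) -natr1; lra.
case: (ltngtP (cell n s) (cell n t)) => c3.
- by apply: Or33; lia.
- by apply: Or32; lia.
- exact: Or31.
Qed.

(** * Construction and continuity of the path [h] *)

Section Reduction.
Variables (R : realType) (f : R -> R) (E : bool -> nat -> R).
Hypothesis cf : continuous f.
Hypothesis Edense : forall c x y, x < y -> exists i, x < E c i < y.
Hypothesis Edisj : forall x, level E true x -> ~ level E false x.
Hypothesis Erat : forall r : rat,
  level E true (f (ratr r)) \/ level E false (f (ratr r)).
Variables u lo hi : R.
Hypothesis lohi : lo < hi.
Hypothesis ulohi : u = lo \/ u = hi.
Hypothesis fu : forall x, lo < x < hi -> f x <> f u.
Hypothesis lu : level E false (f u).

(** The choice is made for all states at once, with a dummy value at invalid ones, so that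
    [piece_at] needs no validity proofs. *)
Let refinement : {F : kind * (bool -> nat) * piece R -> nat -> piece R |
  forall s, valid f E s.1.1 s.1.2 s.2 -> refines f E s.1.1 s.1.2 s.2 (F s)}.
Proof.
have H (s : kind * (bool -> nat) * piece R) :
    exists G, valid f E s.1.1 s.1.2 s.2 -> refines f E s.1.1 s.1.2 s.2 G.
  have [v|nv] := pselect (valid f E s.1.1 s.1.2 s.2); last by exists (fun=> s.2).
  by have [G HG] := refines_exists cf Edense v; exists G.
by have [F HF] := choice H; exists F.
Qed.

(** The root gap is a loop at [u], so the path can rest at [u] beyond the unit interval. *)
Fixpoint piece_at (n k : nat) : piece R :=
  if n is m.+1 then
    sval refinement (kind_at m (k %/ 5), count_at m (k %/ 5), piece_at m (k %/ 5)%N)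
      (k %% 5)%N
  else if k == 0%N then Piece u u lo hi else Piece u u u u.

Definition children_at (n k : nat) : nat -> piece R :=
  sval refinement (kind_at n k, count_at n k, piece_at n k).

Lemma piece_atS (n k : nat) :
  piece_at n.+1 k = children_at n (k %/ 5) (k %% 5).
Proof. by []. Qed.

Lemma refines_children (n k : nat) :
  valid f E (kind_at n k) (count_at n k) (piece_at n k) ->
  refines f E (kind_at n k) (count_at n k) (piece_at n k) (children_at n k).
Proof. by move=> v; apply: (svalP refinement (_, _, _)). Qed.

Lemma piece_valid (n k : nat) :
  valid f E (kind_at n k) (count_at n k) (piece_at n k).
Proof.
elim: n k => [|n IH] k; last first.
  exact: (ref_valid (refines_children (IH (k %/ 5)%N)) (@ltn_pmod k 5 isT)).
rewrite /=; case: eqP => _; split=> //=.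
by rewrite !lexx; split=> // x /le_anti ->.
Qed.

Lemma piece_link (n k : nat) : pb (piece_at n k) = pa (piece_at n k.+1).
Proof.
elim: n k => [|n IH] k; first by rewrite /=; case: eqP.
have q := refines_children (piece_valid n (k %/ 5)).
rewrite !piece_atS.
have [k4|k4] := ltnP (k %% 5)%N 4.
  have -> : (k.+1 %/ 5 = k %/ 5)%N by lia.
  have -> : (k.+1 %% 5 = (k %% 5).+1)%N by lia.
  exact: (ref_link q k4).
have -> : (k.+1 %/ 5 = (k %/ 5).+1)%N by lia.
have -> : (k.+1 %% 5 = 0)%N by lia.
have -> : (k %% 5 = 4)%N by lia.
rewrite (ref_last q) IH.
by rewrite (ref_first (refines_children (piece_valid n (k %/ 5).+1))).
Qed.

Lemma piece_nested (n k : nat) :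
  plo (piece_at n (k %/ 5)) <= plo (piece_at n.+1 k) /\
  phi (piece_at n.+1 k) <= phi (piece_at n (k %/ 5)).
Proof.
exact: (ref_nested (refines_children (piece_valid n (k %/ 5))) (@ltn_pmod k 5 isT)).
Qed.

Section Branch.
Variable k : nat -> nat.
Hypothesis k_div : forall n, (k n.+1 %/ 5 = k n)%N.

Let T n := kind_at n (k n).
Let cnt n := count_at n (k n).
Let d n := piece_at n (k n).
Let F n := children_at n (k n).
Let dg n := (k n.+1 %% 5)%N.

Let Tchild n : T n.+1 = child (T n) (dg n).
Proof. by rewrite /T /= k_div. Qed.

Let cntS n : cnt n.+1 = new_count (T n) (cnt n).
Proof. by rewrite /cnt /= k_div. Qed.

Let dg5 n : (dg n < 5)%N. Proof. exact: ltn_pmod. Qed.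

Let dS n : d n.+1 = F n (dg n).
Proof. by rewrite /d /= k_div. Qed.

Let val n : valid f E (T n) (cnt n) (d n). Proof. exact: piece_valid. Qed.

Let ref n : refines f E (T n) (cnt n) (d n) (F n).
Proof. exact/refines_children/piece_valid. Qed.

Lemma branch_shrinks (e : R) : 0 < e ->
  exists n, width (piece_at n (k n)) < e.
Proof. exact: (chain_shrinks cf Edense Erat Tchild cntS dg5 dS val ref). Qed.

Lemma branch_point : exists y, forall n,
  plo (piece_at n (k n)) <= y <= phi (piece_at n (k n)).
Proof.
have loM n m : (n <= m)%N -> plo (d n) <= plo (d m) /\ phi (d m) <= phi (d n).
  move: m; apply: from_on => // m _ [h1 h2].
  by split; [apply: le_trans h1 (chain_lo dg5 dS ref m)
            |apply: le_trans (chain_hi dg5 dS ref m) h2].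
have cross n m : plo (d n) <= phi (d m).
  have [h1 _] := loM _ _ (leq_maxl n m); have [_ h2] := loM _ _ (leq_maxr n m).
  apply: le_trans h1 (le_trans _ h2).
  by rewrite -subr_ge0; apply: width_ge0 (proj1 (val _)).
exists (sup (range (fun n => plo (d n)))) => n; apply/andP; split.
  apply: sup_upper_bound; last by exists n.
  by split; [exists (plo (d 0%N)), 0%N|exists (phi (d n)) => _ [m _ <-]].
by apply: ge_sup => [|_ [m _ <-]]; [exists (plo (d 0%N)), 0%N|exact: cross].
Qed.

Lemma branch_red (y : R) :
  (forall n, plo (piece_at n (k n)) <= y <= phi (piece_at n (k n))) ->
  ~ infinitely (fun n => ~~ left_color (kind_at n (k n))) ->
  level E true (f y).
Proof. exact: (chain_red cf Edense Erat Tchild cntS dg5 dS val ref). Qed.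

Lemma branch_blue (y : R) :
  (forall n, plo (piece_at n (k n)) <= y <= phi (piece_at n (k n))) ->
  infinitely (fun n => (k n.+1 %% 5)%N <> 4%N) ->
  infinitely (fun n => ~~ left_color (kind_at n (k n))) ->
  ~ level E true (f y).
Proof. exact: (chain_blue cf Edense Edisj Erat Tchild cntS dg5 dS val ref). Qed.

End Branch.

(* König's lemma: wide pieces at every depth would yield a branch of wide
   pieces. *)
Lemma pieces_shrink (e : R) : 0 < e ->
  exists n, forall k, width (piece_at n k) < e.
Proof.
move=> e0; apply: contrapT => H.
pose wide n k := e <= width (piece_at n k).
have H0 n : exists k, wide n k.
  apply: contrapT => H1; apply: H; exists n => k.
  by rewrite ltNge; apply/negP => w; apply: H1; exists k.
have up n k m : wide (n + m)%N k -> wide n (k %/ 5 ^ m)%N.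
  elim: m k => [|m IH] k; first by rewrite addn0 divn1.
  rewrite addnS expnS divnMA => w; apply: IH; apply: le_trans w _.
  by have [h1 h2] := piece_nested (n + m) k; rewrite /width; lra.
(* [Q n k] says that cell [k] of depth [n] has wide descendants at every further depth. *)
pose Q n k := forall m, exists2 k', (k' %/ 5 ^ m = k)%N & wide (n + m)%N k'.
have Q0 : Q 0%N 0%N.
  move=> m; have [k wk] := H0 m; exists k => //.
  have := up 0%N k m wk; rewrite /wide /=; case: eqP => // _.
  by rewrite /width /= subrr leNgt e0.
have QS n k : Q n k -> exists k', (k' %/ 5 = k)%N /\ Q n.+1 k'.
  move=> Qk; apply: contrapT => H1.
  (* If every child [j] fails at some depth [g j], a wide descendant of [k] deeper than all of these
     gives a contradiction. *)
  have H2 j : exists m, (j < 5)%N ->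
      ~ exists2 k', (k' %/ 5 ^ m = 5 * k + j)%N & wide (n.+1 + m)%N k'.
    have [j5|] := ltnP j 5; last by exists 0%N.
    apply: contrapT => H3; apply: H1; exists (5 * k + j)%N.
    split; first by lia.
    by move=> m; apply: contrapT => H4; apply: H3; exists m.
  have [g Hg] := choice H2.
  pose m := (\max_(j < 5) g j)%N.
  have [k' k'E wk'] := Qk m.+1.
  pose j := (k' %/ 5 ^ m %% 5)%N.
  have j5 : (j < 5)%N by exact: ltn_pmod.
  have gm : (g j <= m)%N := @leq_bigmax _ (fun j : 'I_5 => g j) (Ordinal j5).
  apply: (Hg j j5); exists (k' %/ 5 ^ (m - g j))%N.
    rewrite -divnMA -expnD subnK //.
    by move: k'E; rewrite /j expnSr divnMA; lia.
  by apply: up; rewrite addSnnS -addnA addSn subnKC // addnC addSn addnC in wk' *.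
have QP (p : nat * nat) :
    exists k', Q p.1 p.2 -> (k' %/ 5 = p.2)%N /\ Q p.1.+1 k'.
  have [/QS[k' Hk']|nQ] := pselect (Q p.1 p.2); last by exists 0%N.
  by exists k'.
have [g Hg] := choice QP.
pose k := fix k n := if n is m.+1 then g (m, k m) else 0%N.
have Qk n : Q n (k n) by elim: n => [//|n /(Hg (n, k n))[]].
have [n] := @branch_shrinks k (fun n => proj1 (Hg (n, k n) (Qk n))) e e0.
have [k' + w] := Qk n 0%N; rewrite divn1 addn0 in w *.
by move=> <-; rewrite ltNge -/(wide n k') w.
Qed.

(** [h t] is a point common to the boxes of all cells of [t]. For continuity, close points lie in
    equal or adjacent cells, and the boxes of adjacent cells share a point by [piece_link]. *)
Lemma fractal_reduction : exists2 h : R -> R, continuous h &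
  forall t, fractal t <-> level E true (f (h t)).
Proof.
have H (t : R) := @branch_point (fun n => cell n t) (@cell_div _ t).
have [h hin] := choice H.
exists h; last first.
  move=> t; split; first exact: (branch_red (@cell_div _ t) (hin t)).
  by move=> ly Hb; exact: (branch_blue (@cell_div _ t) (hin t) (@cell_not_4 _ t) Hb ly).
move=> t; apply/cvgrPdist_lt => e e0.
have [|n Hn] := @pieces_shrink (e / 2); first by rewrite divr_gt0.
have p5 : 0 < (5 ^+ n)^-1 :> R by rewrite invr_gt0 exprn_gt0.
apply/nbhs_ballP; exists (5 ^+ n)^-1 => //= s; rewrite /ball /= => st.
have {}st : `|t - s| * 5 ^+ n < 1.
  by rewrite -ltr_pdivlMr ?exprn_gt0 // div1r.
have /andP[s1 s2] := hin s n; have /andP[t1 t2] := hin t n.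
have ws := Hn (cell n s); have wt := Hn (cell n t).
have [/fits_bounds[/andP[sa1 sa2] /andP[sb1 sb2]] _] := piece_valid n (cell n s).
have [/fits_bounds[/andP[ta1 ta2] /andP[tb1 tb2]] _] := piece_valid n (cell n t).
rewrite /width in ws wt.
case: (cell_near st) => cst.
- rewrite cst in t1 t2 wt.
  by rewrite ltr_norml; apply/andP; split; lra.
- have := piece_link n (cell n s); rewrite -cst => l.
  by rewrite ltr_norml; apply/andP; split; lra.
- have := piece_link n (cell n t); rewrite -cst => l.
  by rewrite ltr_norml; apply/andP; split; lra.
Qed.

End Reduction.

(** * Enumerations of the red and blue levels *)

Definition red_value (R : realType) (n : nat) : R :=
  if @unpickle rat n is Some q then ratr q else 0.

(** The left summand lists the irrational values of [f] on the rationals, the right one a dense set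
    of irrationals; [pi] fills the remaining indices. *)
Definition blue_value (R : realType) (f : R -> R) (n : nat) : R :=
  match @unpickle (rat + rat)%type n with
  | Some (inl q) => if pselect (rational (f (ratr q))) then pi else f (ratr q)
  | Some (inr q) => pi + ratr q
  | None => pi
  end.

Definition values (R : realType) (f : R -> R) (c : bool) : nat -> R :=
  if c then @red_value R else blue_value f.

Lemma level_red (R : realType) (f : R -> R) (y : R) :
  level (values f) true y <-> rational y.
Proof.
split=> [[n ->]|[q _ <-]] /=.
  rewrite /red_value; case: unpickle => [q|]; first by exists q.
  by exists 0 => //; rewrite rmorph0.
by exists (pickle q); rewrite /values /red_value pickleK.
Qed.

Lemma level_blue (R : realType) (f : R -> R) (y : R) :
  level (values f) false y -> ~ rational y.
Proof.
move=> [n ->] /=; rewrite /blue_value.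
case: unpickle => [[q|q]|]; [|move=> [s _ sE]|exact: pi_irrationnal].
  by case: pselect => //= _; exact: pi_irrationnal.
apply: (@pi_irrationnal R); exists (s - q) => //.
by rewrite rmorphB /= sE addrK.
Qed.

Lemma values_dense (R : realType) (f : R -> R) (c : bool) (x y : R) :
  x < y -> exists i, x < values f c i < y.
Proof.
case: c => xy.
  have [q] := rat_in_itvoo xy; rewrite in_itv /= => qi.
  by exists (pickle q); rewrite /values /red_value pickleK.
have [|q] := @rat_in_itvoo R (x - pi) (y - pi); first by rewrite ltrD2r.
rewrite in_itv /= ltrBlDl ltrBrDl => qi.
by exists (pickle (inr q : rat + rat)%type); rewrite /values /blue_value pickleK.
Qed.

Lemma values_rat (R : realType) (f : R -> R) (q : rat) :
  level (values f) true (f (ratr q)) \/ level (values f) false (f (ratr q)).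
Proof.
have [rq|nrq] := pselect (rational (f (ratr q))).
  by left; apply/level_red.
right; exists (pickle (inl q : rat + rat)%type).
by rewrite /values /blue_value pickleK; case: pselect.
Qed.

(** * Minimality of [fractal] *)

Lemma reducible_fractal (R : realType) (f : R -> R) (a b : R) :
  continuous f -> f a <> f b -> reducible (@fractal R) (f @^-1` @rational R).
Proof.
move=> cf fab.
pose E := values f.
have Edense := @values_dense R f.
have Edisj x : level E true x -> ~ level E false x.
  by move=> /level_red rx /level_blue.
have Erat := @values_rat R f.
have [i [z _ fz]] : exists i, exists2 z,
    Num.min a b - 1 < z < Num.max a b + 1 & f z = E false i.
  apply: (level_between cf Edense (x := a) (y := b)) => //.
    by case: (leP a b) => ?; apply/andP; split; lra.
  by case: (leP a b) => ?; apply/andP; split; lra.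
have [w fw] : exists w, f w <> f z.
  have [fza|fza] := pselect (f a = f z); last by exists a.
  by exists b; rewrite -fza; exact: nesym.
have lz : level E false (f z) by exists i.
(* The last or first hit of the blue level of [z], seen from [w], bounds a one-sided interval that
   avoids this level; it carries the root loop. *)
have [u [lo [hi [lohi ulohi fu lu]]]] : exists u lo hi,
    [/\ lo < hi, u = lo \/ u = hi, forall x, lo < x < hi -> f x <> f u &
      level E false (f u)].
  have [zw|/ltW wz] := leP z w.
    have [u [_ uw uE H]] := last_hit cf zw erefl fw.
    exists u, u, w; split; [by []|by left| |by rewrite uE].
    by move=> x /andP[ux xw]; rewrite uE; apply: H => //; apply: ltW.
  have [u [wu _ uE H]] := first_hit cf wz erefl fw.
  exists u, w, u; split; [by []|by right| |by rewrite uE].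
  by move=> x /andP[wx xu]; rewrite uE; apply: H => //; apply: ltW.
have [h ch hE] := fractal_reduction cf Edense Edisj Erat lohi ulohi fu lu.
exists h => //; apply/funext => t; apply/propext.
by rewrite hE; exact: level_red.
Qed.

Lemma kind_at_mul5 (n k : nat) : kind_at n.+1 (5 * k) = child (kind_at n k) 0.
Proof. by rewrite /= mulKn // modnMr. Qed.

Lemma fractal_nontrivial (R : realType) : nontrivial (@fractal R).
Proof.
split.
  (* 1/5 is the left end of the first red portion, and child 0 of a portion is a portion of the same
     color. *)
  have cellE n : cell n.+1 (5^-1 : R) = (5 ^ n)%N.
    rewrite /cell ger0_norm ?invr_ge0 // exprS mulKf ?pnatr_eq0 //.
    by rewrite -natrX natrK.
  exists (5^-1 : R) => /= /(_ 1%N)[[//|n] _].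
  have -> : kind_at n.+1 (cell n.+1 (5^-1 : R)) = Portion true; last by [].
  rewrite cellE.
  by elim: n => [//|n IH]; rewrite expnS kind_at_mul5 IH.
(* 1 is the left end of the blue plateau that follows the root gap. *)
exists 1; apply=> N; exists N => //.
have -> : cell N (1 : R) = (5 ^ N)%N.
  by rewrite /cell normr1 mul1r -natrX natrK.
have -> : kind_at N (5 ^ N) = Plateau false; last by [].
by elim: N => [//|N IH]; rewrite expnS kind_at_mul5 IH.
Qed.

Theorem theorem1p6 (R : realType) :
  exists A : set R, minimal A /\ reducible A (@rational R).
Proof.
have fid : continuous (@id R) by move=> x; exact: cvg_id.
have [f cf fE] : reducible (@fractal R) (@rational R).
  by have := @reducible_fractal R id 0 1 fid; apply; apply/eqP; rewrite eq_sym oner_eq0.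
exists (@fractal R); split; last by exists f.
split; first exact: fractal_nontrivial.
move=> B [[x Bx] [y By]] [g cg gE].
(* Any nontrivial [B] below [fractal] is the preimage of the rationals under [f \o g], which is not
   constant. *)
have cfg : continuous (f \o g) by move=> z; apply: continuous_comp; [exact: cg|exact: cf].
have BE : B = (f \o g) @^-1` @rational R by rewrite gE fE.
rewrite BE; apply: (@reducible_fractal _ _ x y) => // fxy.
by apply: By; move: Bx; rewrite BE /preimage /=; move: fxy => /= ->.
Qed.
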